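(* Let $I$ be a nonempty open interval of $\mathbb{R}$ and $f:I\to(0,+\infty)$ be a strictly monotonic and infinitely differentiable function with $f(I)=(0,+\infty)$. Let $M$ be the integral mean of the second kind associated with $f$, i.e. the mean satisfying $M(f(x),f(y))=\frac{1}{y-x}\int_x^y f(t)\,dt$ for all $x,y\in I$ with $x\neq y$. Then $$Q_M=\frac16\,\frac{(f^{-1})''}{(f^{-1})'}.$$
   Context: A mean is a function $M:(0,+\infty)^2\to(0,+\infty)$ of class $C^\infty$ such that $\min(x,y)\le M(x,y)\le\max(x,y)$ and $M(x,y)=M(y,x)$ for all $x,y>0$. In particular, the integral mean $M$ is by definition of class $C^\infty$. The characteristic function of a mean $M$ is $Q_M:(0,+\infty)\to\mathbb{R}$, $Q_M(x):=\frac{\partial^2 M}{\partial x^2}(x,x)$ (second partial derivative with respect to the first variable, evaluated at $(x,x)$). Here $f^{-1}:(0,+\infty)\to I$ is the inverse function of $f$. *)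

(* Defs.v *)
From Stdlib Require Import Reals.
From Coquelicot Require Import Coquelicot.
Open Scope R_scope.

(** Functions with a restricted domain are total functions on [R] (or [R * R])
    together with hypotheses on the domain only.  All domains are open, so the
    derivatives at their points depend only on the values on the domain. *)

(** The open interval (a, b), with possibly infinite end points. *)
Definition open_itv (a b : Rbar) (x : R) : Prop :=
  Rbar_lt a x /\ Rbar_lt x b.

Definition infinitely_differentiable_on (I : R -> Prop) (f : R -> R) : Prop :=
  forall (n : nat) (x : R), I x -> ex_derive_n f n x.

Definition strictly_monotonic_on (I : R -> Prop) (f : R -> R) : Prop :=
  (forall x y, I x -> I y -> x < y -> f x < f y) \/
  (forall x y, I x -> I y -> x < y -> f y < f x).

Definition image_is_positive_reals (I : R -> Prop) (f : R -> R) : Prop :=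
  forall u, (exists x, I x /\ f x = u) <-> 0 < u.

(** [g] restricted to the positive reals is the inverse of [f : I -> (0, +oo)]. *)
Definition is_inverse_on (I : R -> Prop) (f g : R -> R) : Prop :=
  (forall x, I x -> g (f x) = x) /\
  (forall u, 0 < u -> I (g u) /\ f (g u) = u).

Definition partial1 (F : R -> R -> R) : R -> R -> R :=
  fun x y => Derive (fun t => F t y) x.

Definition partial2 (F : R -> R -> R) : R -> R -> R :=
  fun x y => Derive (fun t => F x t) y.

(** [F] is of class C^n on the open quadrant (0, +oo)^2; continuity is joint. *)
Fixpoint class_C (n : nat) (F : R -> R -> R) : Prop :=
  match n with
  | O => forall x y, 0 < x -> 0 < y -> continuity_2d_pt F x y
  | S m =>
      (forall x y, 0 < x -> 0 < y ->
         ex_derive (fun t => F t y) x /\ ex_derive (fun t => F x t) y) /\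
      class_C m (partial1 F) /\ class_C m (partial2 F)
  end.

Definition class_C_infinity (F : R -> R -> R) : Prop :=
  forall n : nat, class_C n F.

Definition is_mean (M : R -> R -> R) : Prop :=
  (forall x y, 0 < x -> 0 < y -> 0 < M x y) /\
  class_C_infinity M /\
  (forall x y, 0 < x -> 0 < y -> Rmin x y <= M x y <= Rmax x y) /\
  (forall x y, 0 < x -> 0 < y -> M x y = M y x).

Definition characteristic_function (M : R -> R -> R) (x : R) : R :=
  partial1 (partial1 M) x x.

Definition is_integral_mean_second_kind
    (I : R -> Prop) (f : R -> R) (M : R -> R -> R) : Prop :=
  is_mean M /\
  (forall x y, I x -> I y -> x <> y ->
     M (f x) (f y) = 1 / (y - x) * RInt f x y).

(* Main.v *)
Require Import Defs.
From Stdlib Require Import Reals Lra.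
From Coquelicot Require Import Coquelicot.
Open Scope R_scope.

(** Fix [u > 0] and let [x = f^-1(u)].  For [y] in the interval, the definition
    of [M] and its symmetry give
      (y - x) M(f(y), u) = int_x^y f,
    so that the function [p(y) = M(f(y), u)] satisfies
    [((y - x) p(y))' = f(y)].  Differentiating twice more and evaluating at [x]
    gives [3 p''(x) = f''(x)] ([derive2_average]).  By the chain rule
    [p''(x) = Q_M(u) f'(x)^2 + (d_1 M)(u, u) f''(x)], and
    [(d_1 M)(u, u) = 1/2], because the two partial derivatives of [M] agree on
    the diagonal by symmetry and add up to the derivative of [M(t, t) = t]
    ([mean_partial1_diagonal]).  Hence [6 Q_M(u) f'(x)^2 = - f''(x)]
    ([integral_mean_characteristic]), and the formula follows from
    [(f^-1)' = 1 / f'(x)] and [(f^-1)'' = - f''(x) / f'(x)^3].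

    The inverse function is differentiable only where [f'] does not vanish,
    and strict monotonicity does not ensure this.  It is the smoothness of [M]
    that does ([integral_mean_derive_nonzero]).  Since [(d_1 M)(u, u) = 1/2],
    the average of [f - u] over [[x, y]] is equivalent to [(f(y) - u) / 2] when
    [y] tends to [x], as for an affine function.  If [f'(x) = 0], then [f - u]
    vanishes to order at least 2 at [x]; a power of degree [k] has average
    [1 / (k + 1)] times its end value, which for [k >= 2] is less than [1/2].
    The comparison of growth exponents in [growth_exponent_contradiction] turns
    this into a proof that also covers a function [f] that is flat to infinite
    order at [x]. *)

(** * Open intervals and inverse functions *)

Lemma locally_open_itv (a b : Rbar) (x : R) :
  open_itv a b x -> locally x (open_itv a b).
Proof.
intros [Hax Hxb].
apply filter_and.
- exact (open_Rbar_gt a x Hax).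
- exact (open_Rbar_lt b x Hxb).
Qed.

Lemma open_itv_convex (a b : Rbar) (x y z : R) :
  open_itv a b x -> open_itv a b y -> Rmin x y <= z <= Rmax x y ->
  open_itv a b z.
Proof.
intros [Hax Hxb] [Hay Hyb] [Hmin Hmax].
split.
- apply Rbar_lt_le_trans with (Rmin x y); [|exact Hmin].
  unfold Rmin; destruct (Rle_dec x y); assumption.
- apply Rbar_le_lt_trans with (Rmax x y); [exact Hmax|].
  unfold Rmax; destruct (Rle_dec x y); assumption.
Qed.

Lemma locally_pos (u : R) : 0 < u -> locally u (fun v => 0 < v).
Proof. exact (open_gt 0 u). Qed.

Lemma injective_of_inverse (I : R -> Prop) (f g : R -> R) (x y : R) :
  is_inverse_on I f g -> I x -> I y -> x <> y -> f x <> f y.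
Proof.
intros [gf _] Ix Iy Hxy Hf.
apply Hxy; rewrite <- (gf x Ix), <- (gf y Iy), Hf; reflexivity.
Qed.

Lemma strictly_monotonic_reflects_between (I : R -> Prop) (f : R -> R) (x y z : R) :
  strictly_monotonic_on I f -> I x -> I y -> I z ->
  f x < f y < f z \/ f z < f y < f x -> x < z -> x < y < z.
Proof.
intros f_mono Ix Iy Iz Hf Hxz.
assert (Hxy : x < y \/ x = y \/ y < x) by lra.
assert (Hyz : y < z \/ y = z \/ z < y) by lra.
destruct Hxy as [Hxy|[Hxy|Hxy]]; [|subst; lra|];
  (destruct Hyz as [Hyz|[Hyz|Hyz]]; [|subst; lra|]); try lra;
  destruct f_mono as [Hm|Hm];
  pose proof (Hm _ _ Ix Iz Hxz);
  solve [pose proof (Hm _ _ Iy Ix Hxy); lra | pose proof (Hm _ _ Iz Iy Hyz); lra].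
Qed.

Section Inverse.

Variables (I : R -> Prop) (f g : R -> R).
Hypothesis (I_open : forall x, I x -> locally x I).
Hypothesis (f_mono : strictly_monotonic_on I f).
Hypothesis (g_inv : is_inverse_on I f g).

(** Monotonicity and surjectivity give continuity without any regularity of
    [f]: the values of [g] between [f (g u - e)] and [f (g u + e)] stay within
    [e] of [g u]. *)
Lemma continuous_inverse (u : R) : 0 < u -> continuous g u.
Proof.
intros Hu.
destruct g_inv as [gf fg].
destruct (fg u Hu) as [Igu fgu].
apply filterlim_locally; intros eps.
destruct (I_open _ Igu) as [d Hd].
pose (e := Rmin eps d / 2).
assert (He : 0 < e /\ e < eps /\ e < d).
{ pose proof (cond_pos eps); pose proof (cond_pos d).
  unfold e, Rmin; destruct (Rle_dec eps d); lra. }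
assert (Il : I (g u - e)).
{ apply Hd; apply Rabs_def1; unfold minus, plus, opp; simpl; lra. }
assert (Ir : I (g u + e)).
{ apply Hd; apply Rabs_def1; unfold minus, plus, opp; simpl; lra. }
assert (Hbetween : locally u (fun v =>
  f (g u - e) < v < f (g u + e) \/ f (g u + e) < v < f (g u - e))).
{ assert (interval : forall l r, l < u < r -> locally u (fun v => l < v < r)).
  { intros l r Hlr; apply filter_and; [apply (open_gt l)|apply (open_lt r)]; lra. }
  destruct f_mono as [Hm|Hm];
    pose proof (Hm _ _ Il Igu ltac:(lra)); pose proof (Hm _ _ Igu Ir ltac:(lra)).
  - apply (filter_imp (fun v => f (g u - e) < v < f (g u + e))); [tauto|].
    apply interval; lra.
  - apply (filter_imp (fun v => f (g u + e) < v < f (g u - e))); [tauto|].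
    apply interval; lra. }
generalize (filter_and _ _ (locally_pos u Hu) Hbetween).
apply filter_imp; intros v [Hv Hfv].
destruct (fg v Hv) as [Igv fgv].
rewrite <- fgv in Hfv.
pose proof (strictly_monotonic_reflects_between I f (g u - e) (g v) (g u + e)
  f_mono Il Igv Ir Hfv ltac:(lra)).
apply Rabs_def1; unfold minus, plus, opp; simpl; lra.
Qed.

(** The difference quotient of [g] at [u] is the reciprocal of the one of [f] at
    [g u], taken along [g v], which tends to [g u] by continuity. *)
Lemma is_derive_inverse (u l : R) :
  0 < u -> is_derive f (g u) l -> l <> 0 -> is_derive g u (/ l).
Proof.
intros Hu Hf Hl.
destruct g_inv as [gf fg].
destruct (fg u Hu) as [Igu fgu].
assert (slope : is_lim (fun y => / ((f y - u) / (y - g u))) (g u) (/ l)).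
{ apply (is_lim_inv _ (g u) l); [|intros H; inversion H; contradiction].
  apply is_lim_spec; intros eps.
  apply is_derive_Reals in Hf.
  destruct (Hf eps (cond_pos eps)) as [d Hd].
  exists d; intros y Hy Hne.
  assert (Hyd : Rabs (y - g u) < d) by exact Hy.
  specialize (Hd (y - g u) ltac:(lra) Hyd).
  rewrite fgu in Hd.
  rewrite Rplus_minus in Hd.
  exact Hd. }
apply is_derive_Reals; intros eps Heps.
assert (comp : is_lim (fun v => / ((f (g v) - u) / (g v - g u))) u (/ l)).
{ apply (is_lim_comp (fun y => / ((f y - u) / (y - g u))) g u (/ l) (g u)).
  - exact slope.
  - apply is_lim_spec; intros e.
    assert (Hc := proj1 (filterlim_locally _ _) (continuous_inverse u Hu) e).
    destruct Hc as [d Hd]; exists d; intros v Hv _; exact (Hd v Hv).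
  - destruct (locally_pos u Hu) as [d Hd].
    exists d; intros v Hv Hne Heq.
    injection Heq as Heq.
    apply Hne.
    rewrite <- (proj2 (fg v (Hd v Hv))), Heq; exact fgu. }
apply is_lim_spec in comp.
destruct (filter_and _ _ (comp (mkposreal eps Heps))
  (filter_le_within _ _ (locally_pos u Hu))) as [d Hd].
exists d; intros h Hh0 Hh.
assert (Hball : ball u d (u + h)).
{ change (Rabs (u + h - u) < d); replace (u + h - u) with h by ring; exact Hh. }
destruct (Hd (u + h) Hball ltac:(lra)) as [Hlim Hpos].
simpl in Hlim.
destruct (fg (u + h) Hpos) as [Igv fgv].
rewrite fgv in Hlim.
replace ((g (u + h) - g u) / h) with (/ ((u + h - u) / (g (u + h) - g u)));
  [exact Hlim|].
field; repeat split; try lra.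
intros Heq.
assert (g (u + h) = g u) by lra.
assert (u + h = u) by (rewrite <- fgv, <- fgu; congruence).
lra.
Qed.

End Inverse.

(** * Averages of a function *)

(** The fourth hypothesis says that the logarithmic derivative of [|H|] is at
    most [(5/2) / t], hence that [H] does not decrease faster than [t^(5/2)] at
    0; this is incompatible with a cubic bound, as would be any exponent below
    3.  Squaring avoids fractional powers and makes the sign of [H]
    irrelevant. *)
Lemma growth_exponent_contradiction (h H : R -> R) (d C : R) :
  0 < d ->
  (forall t, 0 < t < d -> is_derive H t (h t)) ->
  (forall t, 0 < t < d -> H t <> 0) ->
  (forall t, 0 < t < d -> H t * (2 * t * h t - 5 * H t) <= 0) ->
  (forall t, 0 < t < d -> Rabs (H t) <= C * t ^ 3) ->
  False.
Proof.
intros Hd dH H0 Hgrowth Hcubic.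
pose (K := fun t => H t ^ 2 / t ^ 5).
pose (dK := fun t => H t * (2 * t * h t - 5 * H t) / t ^ 6).
assert (dK_ok : forall t, 0 < t < d -> is_derive K t (dK t)).
{ intros t Ht; unfold K, dK.
  specialize (dH t Ht).
  auto_derive.
  - split; [now exists (h t)|split; [|easy]].
    apply Rgt_not_eq; repeat apply Rmult_lt_0_compat; lra.
  - rewrite (is_derive_unique (fun x : R => H x) _ _ dH : Derive _ _ = _); field; lra. }
assert (K_decr : forall s t, 0 < s < t -> t < d -> K t <= K s).
{ intros s t Hst Htd.
  destruct (MVT_gen K s t dK) as [c [Hc Heq]];
    rewrite Rmin_left, Rmax_right in * by lra.
  - intros x Hx; apply dK_ok; lra.
  - intros x Hx; apply continuity_pt_filterlim.
    apply (ex_derive_continuous K x); exists (dK x); apply dK_ok; lra.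
  - assert (dK c <= 0).
    { unfold dK, Rdiv.
      assert (0 < / c ^ 6) by (apply Rinv_0_lt_compat, pow_lt; lra).
      specialize (Hgrowth c ltac:(lra)); nra. }
    nra. }
assert (K_small : forall t, 0 < t < d -> K t <= C ^ 2 * t).
{ intros t Ht; unfold K.
  assert (0 < t ^ 5) by (apply pow_lt; lra).
  apply Rle_div_l; [assumption|].
  rewrite <- pow2_abs.
  replace (C ^ 2 * t * t ^ 5) with ((C * t ^ 3) ^ 2) by ring.
  apply pow_incr; split; [apply Rabs_pos|apply Hcubic; assumption]. }
assert (Kpos : 0 < K (d / 2)).
{ unfold K; apply Rdiv_lt_0_compat; [|apply pow_lt; lra].
  rewrite <- pow2_abs; apply pow_lt, Rabs_pos_lt, H0; lra. }
(* As [K] is nonincreasing, [K (d / 2) <= K t <= C ^ 2 * t] for small [t];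
   [q] is a value of [t] that makes the right-hand side too small, also when
   [C = 0]. *)
pose (q := K (d / 2) / (C ^ 2 + 1)).
assert (C2 : 0 < C ^ 2 + 1) by nra.
assert (Hq : 0 < q) by (apply Rdiv_lt_0_compat; assumption).
assert (HqK : q * (C ^ 2 + 1) = K (d / 2)) by (unfold q; field; lra).
pose (t := Rmin q (d / 4)).
assert (Ht : 0 < t /\ t <= q /\ t <= d / 4).
{ unfold t, Rmin; destruct (Rle_dec q (d / 4)); lra. }
pose proof (K_decr t (d / 2) ltac:(lra) ltac:(lra)).
pose proof (K_small t ltac:(lra)).
nra.
Qed.

Lemma quadratic_bound_at_critical_point (f : R -> R) (x : R) :
  locally x (ex_derive f) -> ex_derive (Derive f) x -> Derive f x = 0 ->
  exists C, locally x (fun y => Rabs (f y - f x) <= C * (y - x) ^ 2).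
Proof.
intros [d1 Hd1] [l Hl] H0.
apply is_derive_Reals in Hl.
destruct (Hl 1 Rlt_0_1) as [d2 Hd2].
exists (Rabs l + 1).
assert (Hd : 0 < Rmin d1 d2) by (apply Rmin_pos; apply cond_pos).
exists (mkposreal _ Hd); intros y Hy.
assert (Hyx : Rabs (y - x) < Rmin d1 d2) by exact Hy.
pose proof (Rmin_l d1 d2); pose proof (Rmin_r d1 d2).
assert (near : forall c, Rmin x y <= c <= Rmax x y -> Rabs (c - x) <= Rabs (y - x)).
{ intros c; unfold Rmin, Rmax, Rabs; destruct (Rle_dec x y);
    destruct (Rcase_abs (c - x)); destruct (Rcase_abs (y - x)); lra. }
assert (der : forall c, Rmin x y <= c <= Rmax x y -> ex_derive f c).
{ intros c Hc; apply Hd1; change (Rabs (c - x) < d1); specialize (near c Hc); lra. }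
destruct (MVT_gen f x y (Derive f)) as [c [Hc Heq]].
- intros z Hz; apply Derive_correct, der; lra.
- intros z Hz; apply continuity_pt_filterlim.
  apply (ex_derive_continuous f z), der, Hz.
- rewrite Heq, Rabs_mult.
  specialize (near c Hc).
  assert (Rabs (Derive f c) <= (Rabs l + 1) * Rabs (c - x)).
  { destruct (Req_dec c x) as [->|Hcx].
    - rewrite H0, Rabs_R0, Rminus_diag, Rabs_R0; lra.
    - specialize (Hd2 (c - x) ltac:(lra) ltac:(lra)).
      replace (x + (c - x)) with c in Hd2 by ring.
      rewrite H0, Rminus_0_r in Hd2.
      replace (Derive f c) with ((Derive f c / (c - x) - l + l) * (c - x))
        by (field; lra).
      rewrite Rabs_mult.
      apply Rmult_le_compat_r; [apply Rabs_pos|].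
      pose proof (Rabs_triang (Derive f c / (c - x) - l) l); lra. }
  rewrite <- (pow2_abs (y - x)).
  replace ((Rabs l + 1) * Rabs (y - x) ^ 2)
    with ((Rabs l + 1) * Rabs (y - x) * Rabs (y - x)) by ring.
  apply Rmult_le_compat_r; [apply Rabs_pos|].
  pose proof (Rabs_pos l); nra.
Qed.

(** Here [p] stands for the average of [f] over [[x, y]].  The last hypothesis is
    a quantitative form of [p - f x] being equivalent to half of [f - f x]: with
    [H] the integral of [f - f x] from [x], it bounds the ratio of
    [(y - x) H'(y)] to [H(y)] by [5/2], whereas [f' x = 0] would make [H] of
    order at least 3. *)
Lemma derive_nonzero_of_half_average (f p : R -> R) (x : R) :
  locally x (ex_derive f) -> ex_derive (Derive f) x ->
  locally x (fun y => y <> x -> f y <> f x) ->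
  locally x (fun y => is_derive (fun z => (z - x) * (p z - f x)) y (f y - f x)) ->
  locally x (fun y => Rabs (p y - f x - (f y - f x) / 2) <= Rabs (f y - f x) / 10) ->
  Derive f x <> 0.
Proof.
intros f_der f_der2 f_inj p_der p_half H0.
destruct (quadratic_bound_at_critical_point f x f_der f_der2 H0) as [C f_quad].
destruct (filter_and _ _ (filter_and _ _ f_inj f_quad)
  (filter_and _ _ p_der p_half)) as [d Hd].
assert (Hball : forall t, 0 < t < d -> ball x d (x + t)).
{ intros t Ht; change (Rabs (x + t - x) < d).
  replace (x + t - x) with t by ring; rewrite Rabs_pos_eq; lra. }
apply (growth_exponent_contradiction (fun t => f (x + t) - f x)
  (fun t => t * (p (x + t) - f x)) d C (cond_pos d));
  intros t Ht; destruct (Hd (x + t) (Hball t Ht)) as [[inj quad] [der half]];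
  assert (Hne := inj ltac:(lra));
  set (w := p (x + t) - f x) in *; set (v := f (x + t) - f x) in *;
  assert (Hv : v <> 0) by (unfold v; lra).
- apply (is_derive_ext (fun s => (x + s - x) * (p (x + s) - f x))).
  { assert (E : forall s : R, (x + s - x) * (p (x + s) - f x) = s * (p (x + s) - f x))
      by (intros s; ring).
    exact E. }
  assert (Hs : is_derive (fun s => x + s) t 1) by (auto_derive; auto).
  assert (Hc := is_derive_comp (fun z => (z - x) * (p z - f x)) (fun s => x + s)
    t _ _ der Hs).
  rewrite <- (Rmult_1_l v); exact Hc.
- apply Rmult_integral_contrapositive; split; [lra|].
  revert half; unfold Rabs; repeat destruct Rcase_abs; lra.
- assert (0 <= v * w /\ v * w <= 5 / 2 * w ^ 2).
  { revert half; unfold Rabs; repeat destruct Rcase_abs; intros; split; nra. }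
  replace (t * w * (2 * t * v - 5 * (t * w)))
    with (t ^ 2 * (2 * (v * w) - 5 * w ^ 2)) by ring.
  assert (0 < t ^ 2) by (apply pow_lt; lra).
  nra.
- replace (x + t - x) with t in quad by ring.
  rewrite Rabs_mult, (Rabs_pos_eq t) by lra.
  assert (Rabs w <= Rabs v).
  { revert half; unfold Rabs; repeat destruct Rcase_abs; lra. }
  replace (C * t ^ 3) with (t * (C * t ^ 2)) by ring.
  apply Rmult_le_compat_l; lra.
Qed.

(** If [p] is the average of [f] over [[x, y]], then [f = p + (y - x) p'] and
    [f' = 2 p' + (y - x) p''].  At [y = x] the derivative of the last term is
    [p'' x]. *)
Lemma derive2_average (f f1 p p1 p2 : R -> R) (x : R) :
  locally x (fun y => is_derive (fun z => (z - x) * p z) y (f y)) ->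
  locally x (fun y => is_derive f y (f1 y)) ->
  locally x (fun y => is_derive p y (p1 y)) ->
  locally x (fun y => is_derive p1 y (p2 y)) ->
  ex_derive p2 x ->
  is_derive f1 x (3 * p2 x).
Proof.
intros Hav Hf Hp Hp1 [p3 Hp2].
assert (Ef : locally x (fun y => f y = p y + (y - x) * p1 y)).
{ generalize (filter_and _ _ Hav Hp).
  apply filter_imp; intros y [Hy Hpy].
  rewrite <- (is_derive_unique _ _ _ Hy).
  apply is_derive_unique; auto_derive; [now exists (p1 y)|].
  rewrite (is_derive_unique (fun x0 : R => p x0) _ _ Hpy : Derive _ _ = _); ring. }
assert (Ef1 : locally x (fun y => f1 y = 2 * p1 y + (y - x) * p2 y)).
{ generalize (filter_and _ _ (filter_and _ _ (locally_locally _ _ Ef) Hf)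
    (filter_and _ _ Hp Hp1)).
  apply filter_imp; intros y [[Ey Hfy] [Hpy Hp1y]].
  rewrite <- (is_derive_unique _ _ _ Hfy), (Derive_ext_loc _ _ _ Ey).
  apply is_derive_unique; auto_derive;
    [split; [now exists (p1 y)|split; [now exists (p2 y)|easy]]|].
  rewrite (is_derive_unique (fun x0 : R => p x0) _ _ Hpy : Derive _ _ = _),
    (is_derive_unique (fun x0 : R => p1 x0) _ _ Hp1y : Derive _ _ = _); ring. }
apply (is_derive_ext_loc (fun y => 2 * p1 y + (y - x) * p2 y)).
{ revert Ef1; apply filter_imp; intros y ->; reflexivity. }
assert (Hp1x := locally_singleton _ _ Hp1).
auto_derive; [split; [now exists (p2 x)|split; [now exists p3|easy]]|].
rewrite (is_derive_unique (fun x0 : R => p1 x0) _ _ Hp1x : Derive _ _ = _); ring.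
Qed.

(** * Means on the diagonal *)

Lemma mean_diagonal (M : R -> R -> R) (x : R) : is_mean M -> 0 < x -> M x x = x.
Proof.
intros [_ [_ [Hb _]]] Hx.
specialize (Hb x x Hx Hx).
rewrite Rmin_left, Rmax_left in Hb by lra; lra.
Qed.

(** Existence of the partial derivatives and continuity of one of them suffice
    for total differentiability, which the chain rule along the diagonal
    needs. *)
Lemma class_C_1_differentiable (F : R -> R -> R) (x y : R) :
  class_C 1 F -> 0 < x -> 0 < y ->
  differentiable_pt_lim F x y (partial1 F x y) (partial2 F x y).
Proof.
intros [Hex [Hc _]] Hx Hy.
apply filterdiff_differentiable_pt_lim.
apply (is_derive_filterdiff F x y (partial1 F) (partial2 F x y)).
- apply (locally_2d_locally
    (fun u v => is_derive (fun z => F z v) u (partial1 F u v))).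
  exists (mkposreal _ (Rmin_pos _ _ Hx Hy)); simpl; intros u v Hu Hv.
  pose proof (Rmin_l x y); pose proof (Rmin_r x y).
  apply Rabs_def2 in Hu; apply Rabs_def2 in Hv.
  apply Derive_correct, Hex; lra.
- apply Derive_correct, Hex; assumption.
- apply continuity_2d_pt_filterlim, Hc; assumption.
Qed.

(** Symmetry makes the two partial derivatives equal on the diagonal, and their
    sum is the derivative of [M t t = t]. *)
Lemma mean_partial1_diagonal (M : R -> R -> R) (x : R) :
  is_mean M -> 0 < x -> partial1 M x x = 1 / 2.
Proof.
intros HM Hx.
assert (Hsym : partial2 M x x = partial1 M x x).
{ apply Derive_ext_loc.
  generalize (locally_pos x Hx); apply filter_imp; intros t Ht.
  apply HM; assumption. }
assert (Hid : derivable_pt_lim (fun t => t) x 1) by exact (derivable_pt_lim_id x).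
assert (Hdiag := derivable_pt_lim_comp_2d M (fun t => t) (fun t => t) x _ _ 1 1
  (class_C_1_differentiable M x x (proj1 (proj2 HM) 1%nat) Hx Hx) Hid Hid).
apply is_derive_Reals, is_derive_unique in Hdiag.
rewrite (Derive_ext_loc _ (fun t => t)), Derive_id, Hsym in Hdiag; [lra|].
generalize (locally_pos x Hx); apply filter_imp; intros t Ht.
apply mean_diagonal; assumption.
Qed.

(** * Integral means of the second kind *)

Section IntegralMean.

Variables (a b : Rbar) (f g : R -> R) (M : R -> R -> R).
Hypothesis (f_mono : strictly_monotonic_on (open_itv a b) f).
Hypothesis (f_smooth : infinitely_differentiable_on (open_itv a b) f).
Hypothesis (f_image : image_is_positive_reals (open_itv a b) f).
Hypothesis (g_inv : is_inverse_on (open_itv a b) f g).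
Hypothesis (M_int : is_integral_mean_second_kind (open_itv a b) f M).

(** By the symmetry of [M], the product under the derivative is the integral of
    [f] from [g u] to [z], also at [z = g u], where both are 0. *)
Lemma is_derive_integral_mean (u y : R) : 0 < u -> open_itv a b y ->
  is_derive (fun z => (z - g u) * M (f z) u) y (f y).
Proof.
intros Hu Iy.
destruct g_inv as [gf fg]; destruct (fg u Hu) as [Igu fgu].
destruct M_int as [M_mean M_eq].
assert (f_cont : forall z, open_itv a b z -> continuous f z).
{ intros z Iz; apply (ex_derive_continuous f z), (f_smooth 1%nat z Iz). }
assert (Hav : forall z, open_itv a b z ->
  (z - g u) * M (f z) u = RInt f (g u) z).
{ intros z Iz.
  destruct (Req_dec z (g u)) as [->|Hz].
  - rewrite RInt_point; unfold zero; simpl; ring.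
  - assert (fz : 0 < f z) by (apply f_image; exists z; auto).
    rewrite (proj2 (proj2 (proj2 M_mean)) (f z) u fz Hu).
    rewrite <- fgu at 2; rewrite M_eq by auto; field; lra. }
apply (is_derive_ext_loc (fun z => RInt f (g u) z)).
- generalize (locally_open_itv a b y Iy); apply filter_imp; intros z Iz.
  symmetry; exact (Hav z Iz).
- apply (is_derive_RInt f (fun z => RInt f (g u) z) (g u) y); [|apply f_cont, Iy].
  generalize (locally_open_itv a b y Iy); apply filter_imp; intros z Iz.
  apply (@RInt_correct R_CompleteNormedModule).
  apply (@ex_RInt_continuous R_CompleteNormedModule).
  intros t Ht; apply f_cont.
  exact (open_itv_convex a b (g u) z t Igu Iz Ht).
Qed.

(** Since [M] has first partial derivative [1/2] on the diagonal, the average of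
    [f] between [g u] and [y] increases half as fast as [f y], to first order,
    which excludes a critical point of [f]. *)
Lemma integral_mean_derive_nonzero (u : R) : 0 < u -> Derive f (g u) <> 0.
Proof.
intros Hu.
assert (Igu : open_itv a b (g u)) by (apply g_inv, Hu).
assert (fgu : f (g u) = u) by (apply g_inv, Hu).
assert (M_mean : is_mean M) by apply M_int.
assert (Inear := locally_open_itv a b (g u) Igu).
apply (derive_nonzero_of_half_average f (fun z => M (f z) u)).
- revert Inear; apply filter_imp; exact (f_smooth 1%nat).
- exact (f_smooth 2%nat _ Igu).
- revert Inear; apply filter_imp; intros y Iy.
  apply (injective_of_inverse (open_itv a b) f g); assumption.
- rewrite fgu; revert Inear; apply filter_imp; intros y Iy.
  apply (is_derive_ext (fun z => (z - g u) * M (f z) u - u * (z - g u))).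
  { assert (E : forall z : R, (z - g u) * M (f z) u - u * (z - g u)
      = (z - g u) * (M (f z) u - u)) by (intros; ring).
    exact E. }
  apply (is_derive_minus (fun z : R => (z - g u) * M (f z) u) (fun z : R => u * (z - g u))).
  + apply is_derive_integral_mean; assumption.
  + auto_derive; [easy|ring].
- rewrite fgu.
  assert (dM : is_derive (fun t => M t u) u (1 / 2)).
  { destruct (proj1 (proj2 M_mean) 1%nat) as [M_d1 _].
    rewrite <- (mean_partial1_diagonal M u M_mean Hu).
    exact (Derive_correct _ _ (proj1 (M_d1 u u Hu Hu))). }
  assert (half : locally (f (g u)) (fun v =>
    Rabs (M v u - u - (v - u) / 2) <= Rabs (v - u) / 10)).
  { rewrite fgu.
    apply is_derive_Reals in dM.
    destruct (dM (1 / 10) ltac:(lra)) as [d Hd].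
    exists d; intros v Hv.
    destruct (Req_dec v u) as [->|Hvu].
    - rewrite mean_diagonal by assumption.
      replace (u - u - (u - u) / 2) with 0 by field.
      rewrite Rminus_diag, Rabs_R0; lra.
    - assert (Hvd : Rabs (v - u) < d) by exact Hv.
      specialize (Hd (v - u) ltac:(lra) Hvd).
      rewrite Rplus_minus, mean_diagonal in Hd by assumption.
      replace (M v u - u - (v - u) / 2)
        with (((M v u - u) / (v - u) - 1 / 2) * (v - u)) by (field; lra).
      rewrite Rabs_mult.
      pose proof (Rabs_pos (v - u)); nra. }
  exact (ex_derive_continuous f (g u) (f_smooth 1%nat _ Igu) _ half).
Qed.

(** Comparison of [f''] with three times the second derivative of
    [fun y => M (f y) u], which the chain rule expresses by the derivatives of
    [M] in its first variable. *)
Lemma integral_mean_characteristic (u : R) : 0 < u ->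
  6 * characteristic_function M u * Derive f (g u) ^ 2
    = - Derive (Derive f) (g u).
Proof.
intros Hu.
assert (Igu : open_itv a b (g u)) by (apply g_inv, Hu).
assert (fgu : f (g u) = u) by (apply g_inv, Hu).
assert (M_mean : is_mean M) by apply M_int.
assert (Inear := locally_open_itv a b (g u) Igu).
assert (f_pos : forall y, open_itv a b y -> 0 < f y).
{ intros y Iy; apply f_image; exists y; auto. }
destruct (proj1 (proj2 M_mean) 3%nat) as [M_d1 [[M_d2 [[M_d3 _] _]] _]].
pose (m0 := fun v => M v u).
pose (m1 := fun v => partial1 M v u).
pose (m2 := fun v => partial1 (partial1 M) v u).
assert (d0 : forall v, 0 < v -> is_derive m0 v (m1 v)).
{ intros v Hv; exact (Derive_correct _ _ (proj1 (M_d1 v u Hv Hu))). }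
assert (d1 : forall v, 0 < v -> is_derive m1 v (m2 v)).
{ intros v Hv; exact (Derive_correct _ _ (proj1 (M_d2 v u Hv Hu))). }
assert (d2 : forall v, 0 < v -> ex_derive m2 v).
{ intros v Hv; exact (proj1 (M_d3 v u Hv Hu)). }
assert (e0 : forall y, open_itv a b y -> is_derive f y (Derive f y)).
{ intros y Iy; apply Derive_correct, (f_smooth 1%nat y Iy). }
assert (e1 : forall y, open_itv a b y ->
  is_derive (Derive f) y (Derive (Derive f) y)).
{ intros y Iy; apply Derive_correct, (f_smooth 2%nat y Iy). }
assert (e2 : ex_derive (Derive (Derive f)) (g u))
  by exact (f_smooth 3%nat _ Igu).
pose (p1 := fun y => Derive f y * m1 (f y)).
pose (p2 := fun y => Derive (Derive f) y * m1 (f y)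
  + Derive f y * (Derive f y * m2 (f y))).
assert (av : is_derive (Derive f) (g u) (3 * p2 (g u))).
{ apply (derive2_average f (Derive f) (fun y => m0 (f y)) p1 p2).
  - revert Inear; apply filter_imp; intros y Iy.
    apply is_derive_integral_mean; assumption.
  - revert Inear; apply filter_imp; exact e0.
  - revert Inear; apply filter_imp; intros y Iy.
    apply (is_derive_comp m0 f y); [apply d0, f_pos|apply e0]; exact Iy.
  - revert Inear; apply filter_imp; intros y Iy.
    apply (is_derive_mult (Derive f) (fun z => m1 (f z)) y
      (Derive (Derive f) y) (Derive f y * m2 (f y))).
    + apply e1, Iy.
    + apply (is_derive_comp m1 f y); [apply d1, f_pos|apply e0]; exact Iy.
    + exact Rmult_comm.
  - assert (Hm1 : ex_derive (fun y => m1 (f y)) (g u)).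
    { apply (ex_derive_comp m1 f).
      - exists (m2 (f (g u))); apply d1, f_pos, Igu.
      - exact (f_smooth 1%nat _ Igu). }
    assert (Hm2 : ex_derive (fun y => m2 (f y)) (g u)).
    { apply (ex_derive_comp m2 f).
      - apply d2, f_pos, Igu.
      - exact (f_smooth 1%nat _ Igu). }
    assert (Hf1 : ex_derive (Derive f) (g u)) by exact (f_smooth 2%nat _ Igu).
    apply (ex_derive_plus (fun y => Derive (Derive f) y * m1 (f y))
      (fun y => Derive f y * (Derive f y * m2 (f y)))).
    + apply ex_derive_mult; assumption.
    + apply ex_derive_mult; [assumption|apply ex_derive_mult; assumption]. }
assert (Heq : Derive (Derive f) (g u) = 3 * p2 (g u))
  by (apply is_derive_unique, av).
unfold p2 in Heq; rewrite fgu in Heq.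
replace (m1 u) with (1 / 2) in Heq
  by (symmetry; apply (mean_partial1_diagonal M u M_mean Hu)).
change (m2 u) with (characteristic_function M u) in Heq.
lra.
Qed.

Lemma integral_mean_is_derive_inverse (u : R) : 0 < u ->
  is_derive g u (/ Derive f (g u)).
Proof.
intros Hu.
apply (is_derive_inverse (open_itv a b) f); try assumption.
- exact (locally_open_itv a b).
- apply Derive_correct, (f_smooth 1%nat), g_inv, Hu.
- apply integral_mean_derive_nonzero, Hu.
Qed.

Lemma integral_mean_is_derive2_inverse (u : R) : 0 < u ->
  is_derive (Derive g) u (- Derive (Derive f) (g u) / Derive f (g u) ^ 3).
Proof.
intros Hu.
assert (Igu : open_itv a b (g u)) by (apply g_inv, Hu).
assert (Hne := integral_mean_derive_nonzero u Hu).
apply (is_derive_ext_loc (fun v => / Derive f (g v))).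
- generalize (locally_pos u Hu); apply filter_imp; intros v Hv.
  symmetry; apply is_derive_unique, integral_mean_is_derive_inverse, Hv.
- replace (- Derive (Derive f) (g u) / Derive f (g u) ^ 3)
    with (- (/ Derive f (g u) * Derive (Derive f) (g u)) / Derive f (g u) ^ 2)
    by (field; exact Hne).
  apply (is_derive_inv (fun v => Derive f (g v))); [|exact Hne].
  apply (is_derive_comp (Derive f) g u).
  + apply Derive_correct, (f_smooth 2%nat _ Igu).
  + apply integral_mean_is_derive_inverse, Hu.
Qed.

End IntegralMean.

Theorem proposition3p33 (a b : Rbar) (hab : Rbar_lt a b)
  (f : R -> R)
  (f_mono : strictly_monotonic_on (open_itv a b) f)
  (f_smooth : infinitely_differentiable_on (open_itv a b) f)
  (f_image : image_is_positive_reals (open_itv a b) f)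
  (g : R -> R) (g_inv : is_inverse_on (open_itv a b) f g)
  (M : R -> R -> R)
  (M_int : is_integral_mean_second_kind (open_itv a b) f M) :
  forall u : R, 0 < u ->
    (ex_derive g u /\ ex_derive_n g 2 u /\ Derive g u <> 0) /\
    characteristic_function M u = 1 / 6 * (Derive_n g 2 u / Derive g u).
Proof.
intros u Hu.
assert (Hne : Derive f (g u) <> 0)
  by (apply (integral_mean_derive_nonzero a b f g M); assumption).
assert (dg : is_derive g u (/ Derive f (g u)))
  by (apply (integral_mean_is_derive_inverse a b f g M); assumption).
assert (ddg : is_derive (Derive g) u
  (- Derive (Derive f) (g u) / Derive f (g u) ^ 3))
  by (apply (integral_mean_is_derive2_inverse a b f g M); assumption).
assert (HQ : 6 * characteristic_function M u * Derive f (g u) ^ 2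
    = - Derive (Derive f) (g u))
  by (apply (integral_mean_characteristic a b f g M); assumption).
assert (Dg : Derive g u = / Derive f (g u)) by (apply is_derive_unique, dg).
assert (DDg : Derive_n g 2 u = - Derive (Derive f) (g u) / Derive f (g u) ^ 3)
  by (apply is_derive_unique, ddg).
split.
- split; [now exists (/ Derive f (g u))|split].
  + exists (- Derive (Derive f) (g u) / Derive f (g u) ^ 3); exact ddg.
  + rewrite Dg; apply Rinv_neq_0_compat, Hne.
- rewrite DDg, Dg, <- HQ; field; exact Hne.
Qed.
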